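(* Let $\Gamma\subseteq\mathbb{R}^d$ be a $d$-dimensional lattice, and let $f^{iso}(m)$ denote the number of coincidence isometries of $\Gamma$ of coincidence index $m$ divided by the order of the point group of $\Gamma$. The following statements are equivalent: (i) $f^{iso}$ is multiplicative, i.e. $f^{iso}(mn)=f^{iso}(m)f^{iso}(n)$ for all coprime positive integers $m,n$. (ii) There exists an ordering $\pi$ of the prime numbers such that every coincidence isometry $R$ of $\Gamma$ has a (unique, up to point group elements) $\pi$-decomposition. (iii) For every ordering $\pi$ of the prime numbers, every coincidence isometry $R$ of $\Gamma$ has a $\pi$-decomposition.
   Context: Let $\Gamma\subseteq\mathbb{R}^d$ be a lattice of full rank $d$. A linear isometry $R\in\mathrm{O}(d)$ is a coincidence isometry of $\Gamma$ if $\Gamma(R):=\Gamma\cap R\Gamma$ has finite index in $\Gamma$. The coincidence isometries form a group $OC(\Gamma)$. The coincidence index is $\Sigma(R):=[\Gamma:\Gamma(R)]$. The point group is the finite group $\mathcal{P}=\{R\in \mathrm{O}(d): R\Gamma=\Gamma\}$. For $m\in\mathbb{N}=\{1,2,\dots\}$, $f^{iso}(m)$ is defined by requiring that $|\mathcal{P}|\,f^{iso}(m)$ is the number of $R\in OC(\Gamma)$ with $\Sigma(R)=m$. An ordering of the prime numbers is a bijection $\pi=\{p_1,p_2,\ldots\}$ from the positive integers onto the set of prime numbers, $i\mapsto p_i$. A $\pi$-decomposition of a coincidence isometry $R$ is a factorization $R=R_1\cdots R_n$ (for some $n$, which may depend on $R$) into coincidence isometries $R_i$ of $\Gamma$ such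 that $\Sigma(R_i)$ is a power of $p_i$ for every $i$; $\Sigma(R_i)=p_i^0=1$ is allowed. Uniqueness of a $\pi$-decomposition is understood up to point group elements: if $R=R_1\cdots R_n=R_1'\cdots R_n'$ are two $\pi$-decompositions (brought to the same length by appending identity factors), then there are $Q_0,Q_1,\ldots,Q_n\in\mathcal{P}$ with $Q_0=Q_n=E$ (the identity) and $R_i'=Q_{i-1}^{-1}R_iQ_i$ for all $i$. *)

(* Defs.v *)
From HB Require Import structures.
From mathcomp Require Import all_boot all_order all_algebra finmap.
From mathcomp Require Import all_classical reals.

Set Implicit Arguments.
Unset Strict Implicit.
Unset Printing Implicit Defensive.

Import Order.TTheory GRing.Theory Num.Theory.

Local Open Scope classical_set_scope.
Local Open Scope ring_scope.

Definition full_rank_lattice (R : realType) (d : nat) (G : set 'cV[R]_d) :=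
  exists2 B : 'M[R]_d, B \in unitmx &
    G = [set B *m map_mx intr z | z in [set: 'cV[int]_d]].

Definition linear_isometry (R : realType) (d : nat) (A : 'M[R]_d) :=
  A^T *m A = 1%:M.

Definition cosets (V : zmodType) (G H : set V) : set (set V) :=
  [set [set x + h | h in H] | x in G].

Definition finite_index (V : zmodType) (G H : set V) :=
  finite_set (cosets G H).

(* [fset_set] sends infinite sets to the empty one, so an infinite index is
   encoded as 0. *)
Definition subgroup_index (V : zmodType) (G H : set V) : nat :=
  #|` fset_set (cosets G H)|.

Definition image_lattice (R : realType) (d : nat) (A : 'M[R]_d)
    (G : set 'cV[R]_d) : set 'cV[R]_d :=
  [set A *m x | x in G].

Definition coincidence_site_lattice (R : realType) (d : nat)
    (G : set 'cV[R]_d) (A : 'M[R]_d) : set 'cV[R]_d :=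
  G `&` image_lattice A G.

Definition coincidence_isometry (R : realType) (d : nat)
    (G : set 'cV[R]_d) (A : 'M[R]_d) :=
  linear_isometry A /\ finite_index G (coincidence_site_lattice G A).

Definition coincidence_index (R : realType) (d : nat)
    (G : set 'cV[R]_d) (A : 'M[R]_d) : nat :=
  subgroup_index G (coincidence_site_lattice G A).

Definition point_group (R : realType) (d : nat) (G : set 'cV[R]_d) :
    set 'M[R]_d :=
  [set A | linear_isometry A /\ image_lattice A G = G].

(* For a lattice of full rank, both sets counted here are finite, so that the
   value of [fset_set] on infinite sets plays no role. *)
Definition f_iso (R : realType) (d : nat) (G : set 'cV[R]_d) (m : nat) : rat :=
  #|` fset_set [set A : 'M[R]_d |
        coincidence_isometry G A /\ coincidence_index G A = m]|%:R
  / #|` fset_set (point_group G)|%:R.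

Definition multiplicative_function (f : nat -> rat) :=
  forall m n : nat, (0 < m)%N -> (0 < n)%N -> coprime m n ->
    f (m * n)%N = f m * f n.

(* Indexed from 0: [p i] is the (i+1)-st prime of the ordering. *)
Definition prime_ordering (p : nat -> nat) :=
  set_bij [set: nat] [set q | prime q] p.

Definition prime_decomposition (R : realType) (d : nat) (G : set 'cV[R]_d)
    (p : nat -> nat) (A : 'M[R]_d) (s : seq 'M[R]_d) :=
  A = \big[mulmx/1%:M]_(B <- s) B /\
  forall i : nat, (i < size s)%N ->
    coincidence_isometry G (nth 1%:M s i) /\
    exists k : nat, coincidence_index G (nth 1%:M s i) = (p i ^ k)%N.

(* The default value of [nth] pads the shorter list with identity factors. *)
Definition equal_up_to_point_group (R : realType) (d : nat)
    (G : set 'cV[R]_d) (s t : seq 'M[R]_d) :=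
  let n := maxn (size s) (size t) in
  exists Q : nat -> 'M[R]_d,
    [/\ forall i : nat, (i <= n)%N -> point_group G (Q i),
        Q 0%N = 1%:M, Q n = 1%:M &
        forall i : nat, (i < n)%N ->
          nth 1%:M t i = invmx (Q i) *m nth 1%:M s i *m Q i.+1].

Definition has_decomposition (R : realType) (d : nat) (G : set 'cV[R]_d)
    (p : nat -> nat) (A : 'M[R]_d) :=
  exists s : seq 'M[R]_d, prime_decomposition G p A s.

Definition unique_decomposition (R : realType) (d : nat) (G : set 'cV[R]_d)
    (p : nat -> nat) (A : 'M[R]_d) :=
  forall s t : seq 'M[R]_d,
    prime_decomposition G p A s -> prime_decomposition G p A t ->
    equal_up_to_point_group G s t.

(* Main.v *)
(* Write S(m) for the set of coincidence isometries of index m and P = S(1) for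
   the point group.  Since coincidence isometries have determinant 1 or -1,
   A and its inverse have the same index, and the index of A B divides the
   product of the indices of A and B, with equality if these are coprime.  For
   coprime m and n, multiplication thus maps S(m) x S(n) into S(m n), and two
   pairs have the same image iff they differ by an element Q of P, as the index
   of Q divides both m ^ 2 and n ^ 2.  So |S(m)| |S(n)| <= |P| |S(m n)|, and
   f(m n) = f(m) f(n) iff every element of S(m n) splits into factors of index m
   and n.  If f is multiplicative, the primes can therefore be split off in any
   order.  Conversely, decompositions for a single ordering p split S(m n)
   whenever m only involves p_0, ..., p_(i-1) and n only the other primes, and
   this suffices to express f through its values at prime powers.  Uniqueness
   always holds: the quotient of two partial products of length i has an index
   involving only p_0, ..., p_(i-1), and also only the other primes. *)

Require Import Defs.
From HB Require Import structures.
From mathcomp Require Import all_boot all_order all_algebra finmap.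
From mathcomp Require Import all_classical reals.
From mathcomp Require Import zify.

Set Implicit Arguments.
Unset Strict Implicit.
Unset Printing Implicit Defensive.

Import Order.TTheory GRing.Theory Num.Theory.

Local Open Scope classical_set_scope.
Local Open Scope ring_scope.

(** * Finite sets and their cardinalities *)

Lemma finite_set_range (T : choiceType) (A : set T) :
  finite_set A -> exists (I : finType) (f : I -> T), injective f /\ A = range f.
Proof.
move=> finA; exists (fset_set A), val; split; first exact: val_inj.
apply/seteqP; split=> [x Ax|_ [i _ <-]].
  have xA : x \in fset_set A by rewrite in_fset_set// inE.
  by exists [` xA]%fset.
by have := valP i; rewrite in_fset_set// inE.
Qed.

Lemma card_fset_set_range (I : finType) (T : choiceType) (f : I -> T) :
  injective f -> #|` fset_set (range f)| = #|I|.
Proof.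
move=> f_inj; rewrite fset_set_image; last exact: finite_finset.
rewrite card_imfset// cardfE.
have memI i : i \in fset_set [set: I].
  by rewrite in_fset_set ?inE//; exact: finite_finset.
apply: (@bij_eq_card _ _ val); exists (fun i => [` memI i]%fset) => // i.
exact: val_inj.
Qed.

Lemma card_fset_setX (T U : choiceType) (A : set T) (B : set U) :
  finite_set A -> finite_set B ->
  #|` fset_set (A `*` B)| = (#|` fset_set A| * #|` fset_set B|)%N.
Proof.
move=> /finite_set_range[I [f [f_inj ->]]] /finite_set_range[J [g [g_inj ->]]].
rewrite !card_fset_set_range// -card_prod.
have -> : range f `*` range g = range (fun u : I * J => (f u.1, g u.2)).
  apply/seteqP; split=> [[x y] [/= [i _ <-] [j _ <-]]|_ [[i j] _ <-]/=].
    by exists (i, j).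
  by split; [exists i | exists j].
by apply: card_fset_set_range => -[i j] [i' j'] /= [/f_inj -> /g_inj ->].
Qed.

(** * Indices of subgroups of an abelian group *)

Definition additive_subgroup (V : zmodType) (G : set V) :=
  G 0 /\ forall x y, G x -> G y -> G (x - y).

(** Representatives are indexed by a finite type, so that the index becomes [#|I|] and an index
    formula is proved by building one transversal from others. *)
Definition coset_transversal (V : zmodType) (G H : set V) (I : finType)
    (r : I -> V) :=
  [/\ forall i, G (r i), forall x, G x -> exists i, H (x - r i) &
      forall i j, H (r i - r j) -> i = j].

Section AdditiveSubgroup.
Variable V : zmodType.
Implicit Types (G H K : set V).

Lemma additive_subgroupN G x : additive_subgroup G -> G x -> G (- x).
Proof. by case=> G0 GB Gx; rewrite -sub0r; apply: GB. Qed.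

Lemma additive_subgroupD G x y :
  additive_subgroup G -> G x -> G y -> G (x + y).
Proof.
move=> sG Gx Gy; rewrite -[y]opprK; apply: sG.2 => //.
exact: additive_subgroupN.
Qed.

Lemma additive_subgroupMn G x n : additive_subgroup G -> G x -> G (x *+ n).
Proof.
move=> sG Gx; elim: n => [|n IHn]; first exact: sG.1.
by rewrite mulrS; apply: additive_subgroupD.
Qed.

Lemma additive_subgroupI G H :
  additive_subgroup G -> additive_subgroup H -> additive_subgroup (G `&` H).
Proof.
move=> [G0 GB] [H0 HB]; split=> // x y [Gx Hx] [Gy Hy].
by split; [apply: GB | apply: HB].
Qed.

Lemma coset_eqP H x y : additive_subgroup H ->
  [set x + h | h in H] = [set y + h | h in H] <-> H (x - y).
Proof.
move=> sH; split=> [eq_xy|Hxy].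
  have : [set y + h | h in H] x.
    by rewrite -eq_xy; exists 0; [exact: sH.1 | rewrite addr0].
  by move=> [h Hh <-]; rewrite [y + h]addrC addrK.
apply/seteqP; split=> _ [h Hh <-].
  exists (x - y + h); first exact: additive_subgroupD.
  by rewrite addrA addrCA subrr addr0.
exists (h - (x - y)); first exact: sH.2.
by rewrite opprB addrCA [x + _]addrC subrK addrC.
Qed.

Lemma coset_transversal_index G H (I : finType) (r : I -> V) :
  additive_subgroup H -> coset_transversal G H r ->
  finite_index G H /\ subgroup_index G H = #|I|.
Proof.
move=> sH [rG r_ex r_inj].
have cosetsE : cosets G H = range (fun i => [set r i + h | h in H]).
  apply/seteqP; split=> [_ [x Gx <-]|_ [i _ <-]]; last by exists (r i).
  by have [i Hi] := r_ex x Gx; exists i => //; apply/esym/coset_eqP.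
rewrite /finite_index /subgroup_index cosetsE; split.
  exact/finite_image/finite_finset.
by apply: card_fset_set_range => i j /coset_eqP -/(_ sH); exact: r_inj.
Qed.

Lemma coset_transversal_exists G H :
  additive_subgroup H -> finite_index G H ->
  exists (I : finType) (r : I -> V), coset_transversal G H r.
Proof.
move=> sH /finite_set_range[I [f [f_inj cosetsE]]].
have /choice[r rP] : forall i, exists x, G x /\ [set x + h | h in H] = f i.
  move=> i; have : cosets G H (f i) by rewrite cosetsE; exists i.
  by move=> [x Gx <-]; exists x.
exists I, r; split=> [i|x Gx|i j Hij]; first by have [] := rP i.
- have : cosets G H [set x + h | h in H] by exists x.
  rewrite cosetsE => -[i _ fi]; exists i; apply/(coset_eqP _ _ sH).
  by rewrite -fi; have [_ ->] := rP i.
- apply: f_inj; have [_ <-] := rP i; have [_ <-] := rP j.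
  exact/coset_eqP.
Qed.

Lemma subgroup_index_gt0 G H :
  additive_subgroup G -> finite_index G H -> (0 < subgroup_index G H)%N.
Proof.
move=> sG finGH; rewrite cardfs_gt0; apply/fset0Pn.
exists [set 0 + h | h in H]; rewrite in_fset_set// inE.
by exists 0 => //; exact: sG.1.
Qed.

Lemma subgroup_index_self G : additive_subgroup G ->
  finite_index G G /\ subgroup_index G G = 1%N.
Proof.
move=> sG; rewrite -card_unit.
apply: (@coset_transversal_index _ _ unit (fun=> 0)) => //.
split=> [_|x Gx|[] []//]; first exact: sG.1.
by exists tt; rewrite subr0.
Qed.

Lemma subgroup_index_eq1 G H :
  additive_subgroup G -> additive_subgroup H -> finite_index G H ->
  subgroup_index G H = 1%N -> G `<=` H.
Proof.
move=> sG sH finGH.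
have [I [r rP]] := coset_transversal_exists sH finGH.
have [_ ->] := coset_transversal_index sH rP.
case: rP => rG r_ex _ /fintype1[i0 Ii0] x Gx.
have [i Hxi] := r_ex x Gx; have [j H0j] := r_ex 0 sG.1.
move: Hxi H0j; rewrite (Ii0 i) (Ii0 j) => Hx H0.
by have := sH.2 _ _ Hx H0; rewrite sub0r opprK subrK.
Qed.

Lemma finite_index_subl G H K :
  K `<=` G -> finite_index G H -> finite_index K H.
Proof.
move=> KG; apply: sub_finite_set => _ [x Kx <-].
by exists x => //; exact: KG.
Qed.

(** Adding [K] to a coset of [H] gives a coset of [K], and every coset of [K] in [G] arises in this
    way. *)
Lemma finite_index_subr G H K :
  additive_subgroup H -> additive_subgroup K -> H `<=` K ->
  finite_index G H -> finite_index G K.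
Proof.
move=> sH sK HK /(finite_image (fun C => [set c + k | c in C & k in K])).
apply: sub_finite_set => _ [x Gx <-].
exists [set x + h | h in H]; first by exists x.
apply/seteqP; split=> [_ [_ [h Hh <-]] [k Kk <-]|_ [k Kk <-]].
  exists (h + k); last by rewrite addrA.
  by apply: additive_subgroupD => //; exact: HK.
exists x; last by exists k.
by exists 0; [exact: sH.1 | rewrite addr0].
Qed.

(** Sums of a representative of [G] modulo [K] and one of [K] modulo [H] form a transversal of [H]
    in [G]. *)
Lemma subgroup_index_trans G H K :
  additive_subgroup G -> additive_subgroup H -> additive_subgroup K ->
  H `<=` K -> K `<=` G -> finite_index G K -> finite_index K H ->
  finite_index G H /\
  subgroup_index G H = (subgroup_index G K * subgroup_index K H)%N.
Proof.
move=> sG sH sK HK KG finGK finKH.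
have [I [r rP]] := coset_transversal_exists sK finGK.
have [J [s sP]] := coset_transversal_exists sH finKH.
have [_ ->] := coset_transversal_index sK rP.
have [_ ->] := coset_transversal_index sH sP.
rewrite -card_prod.
case: rP sP => [rG r_ex r_inj] [sK' s_ex s_inj].
apply: (@coset_transversal_index _ _ _ (fun u : I * J => r u.1 + s u.2)) => //.
split=> [[i j]|x Gx|[i j] [i' j']] /=.
- by apply: additive_subgroupD => //; exact/KG.
- have [i Ki] := r_ex x Gx; have [j Hj] := s_ex _ Ki.
  by exists (i, j); rewrite /= opprD addrA.
- move=> Hij; have eq_i : i = i'.
    apply: r_inj.
    have -> : r i - r i' = (r i + s j - (r i' + s j')) - (s j - s j').
      by rewrite opprD addrACA addrK.
    by apply: sK.2; [exact: HK | exact: sK.2].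
  move: Hij; rewrite eq_i opprD addrACA subrr add0r => Hij.
  by rewrite (s_inj _ _ Hij).
Qed.

Lemma subgroup_index_tower G H K :
  additive_subgroup G -> additive_subgroup H -> additive_subgroup K ->
  H `<=` K -> K `<=` G -> finite_index G H ->
  [/\ finite_index G K, finite_index K H &
      subgroup_index G H = (subgroup_index G K * subgroup_index K H)%N].
Proof.
move=> sG sH sK HK KG finGH.
have finGK := finite_index_subr sH sK HK finGH.
have finKH := finite_index_subl KG finGH.
by split=> //; have [] := subgroup_index_trans sG sH sK HK KG finGK finKH.
Qed.

(** By the second isomorphism theorem the index of [K] modulo its intersection with [H] equals that
    of [K + H] modulo [H], which divides the index of [H] in [G] by the tower formula. *)
Lemma subgroup_index_capr G H K :
  additive_subgroup G -> additive_subgroup H -> additive_subgroup K ->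
  K `<=` G -> H `<=` G -> finite_index G H ->
  finite_index K (K `&` H) /\
  (subgroup_index K (K `&` H) %| subgroup_index G H)%N.
Proof.
move=> sG sH sK KG HG finGH.
pose KH := [set k + h | k in K & h in H].
have sKH : additive_subgroup KH.
  split=> [|_ _ [k Kk [h Hh <-]] [k' Kk' [h' Hh' <-]]].
    by exists 0; [exact: sK.1 | exists 0; [exact: sH.1 | rewrite addr0]].
  exists (k - k'); first exact: sK.2.
  by exists (h - h'); [exact: sH.2 | rewrite opprD addrACA].
have HKH : H `<=` KH.
  by move=> h Hh; exists 0; [exact: sK.1 | exists h => //; rewrite add0r].
have KKH : K `<=` KH.
  by move=> k Kk; exists k => //; exists 0; [exact: sH.1 | rewrite addr0].
have KHG : KH `<=` G.
  move=> _ [k Kk [h Hh <-]].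
  by apply: additive_subgroupD => //; [exact: KG | exact: HG].
have [_ finKH ->] := subgroup_index_tower sG sH sKH HKH KHG finGH.
have sI := additive_subgroupI sK sH.
have finK : finite_index K (K `&` H).
  (* A coset of the intersection is the trace on [K] of a coset of [H]. *)
  apply: sub_finite_set (finite_image (setI K) finKH).
  move=> _ [x Kx <-]; exists [set x + h | h in H].
    by exists x => //; exact: KKH.
  apply/seteqP; split=> [y [Ky [h Hh xh]]|_ [h [Kh Hh] <-]].
    exists h => //; split=> //.
    by have := sK.2 _ _ Ky Kx; rewrite -xh addrAC subrr add0r.
  by split; [exact: additive_subgroupD | exists h].
split=> //; apply: dvdn_mull.
suff -> : subgroup_index KH H = subgroup_index K (K `&` H) by [].
have [I [r rP]] := coset_transversal_exists sI finK.
have [_ ->] := coset_transversal_index sI rP.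
(* The transversal of the intersection in [K] is also one of [H] in [K + H]. *)
have [//|_ ->//] := @coset_transversal_index KH H I r sH _.
case: rP => rK r_ex r_inj; split=> [i|_ [k Kk [h Hh <-]]|i j Hij].
- exact: KKH.
- have [i [_ Hi]] := r_ex k Kk; exists i.
  by rewrite addrAC; apply: additive_subgroupD.
- by apply: r_inj; split=> //; exact: sK.2.
Qed.

(** Let [n] be the index. By the pigeonhole principle two of the multiples of [x] by 0, ..., [n] lie
    in one coset. Their difference is a multiple of [x] by some number between 1 and [n], and this
    number divides the factorial. *)
Lemma subgroup_index_factorial G H x :
  additive_subgroup G -> additive_subgroup H -> finite_index G H ->
  G x -> H (x *+ (subgroup_index G H)`!).
Proof.
move=> sG sH finGH Gx.
have [I [r rP]] := coset_transversal_exists sH finGH.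
have [_ ->] := coset_transversal_index sH rP.
case: rP => rG r_ex r_inj.
have /choice[c cP] : forall k : 'I_#|I|.+1, exists i, H (x *+ k - r i).
  by move=> k; apply: r_ex; exact: additive_subgroupMn.
have /injectivePn[k [l neq_kl eq_c]] : ~~ injectiveb c.
  apply/negP => /injectiveP/leq_card; rewrite card_ord.
  by rewrite ltnn.
have {c cP eq_c} Hkl : H (x *+ k - x *+ l).
  have := sH.2 _ _ (cP k) (cP l).
  by rewrite eq_c opprB addrA subrK.
wlog lt_lk : k l neq_kl Hkl / (l < k)%N.
  move=> wlog_lk; have [|/(wlog_lk _ _ neq_kl Hkl)//|eq_lk] := ltngtP k l.
    move=> /(wlog_lk l k); apply; first by rewrite eq_sym.
    by rewrite -opprB; exact: additive_subgroupN.
  by rewrite (val_inj eq_lk) eqxx in neq_kl.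
rewrite -mulrnBr in Hkl; last exact: ltnW.
have /dvdnP[q ->] : (k - l %| (#|I|)`!)%N.
  apply: dvdn_fact; rewrite subn_gt0 lt_lk /=.
  by rewrite (leq_trans (leq_subr _ _))// -ltnS.
by rewrite mulnC mulrnA; exact: additive_subgroupMn.
Qed.

End AdditiveSubgroup.

Lemma additive_subgroup_image (V W : zmodType) (f : {additive V -> W})
    (G : set V) :
  additive_subgroup G -> additive_subgroup (f @` G).
Proof.
move=> [G0 GB]; split=> [|_ _ [x Gx <-] [y Gy <-]].
  by exists 0; rewrite ?raddf0.
by exists (x - y); [exact: GB | rewrite raddfB].
Qed.

Lemma subgroup_index_image (V W : zmodType) (f : {additive V -> W})
    (G H : set V) :
  injective f -> additive_subgroup H -> finite_index G H ->
  finite_index (f @` G) (f @` H) /\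
  subgroup_index (f @` G) (f @` H) = subgroup_index G H.
Proof.
move=> f_inj sH finGH.
have [I [r rP]] := coset_transversal_exists sH finGH.
have [_ ->] := coset_transversal_index sH rP.
apply: (@coset_transversal_index W (f @` G) (f @` H) I (fun i => f (r i))).
  exact: additive_subgroup_image.
case: rP => rG r_ex r_inj; split=> [i|_ [x Gx <-]|i j].
- by exists (r i).
- by have [i Hi] := r_ex x Gx; exists i, (x - r i); rewrite ?raddfB.
- move=> [h Hh]; rewrite /= -raddfB => /f_inj hE.
  by apply: r_inj; rewrite -hE.
Qed.

(** * Indices of images of integer matrices *)

Lemma absz_det_unit (d : nat) (L : 'M[int]_d) :
  L \in unitmx -> `|\det L|%N = 1%N.
Proof.
move=> /mulmxV/(congr1 (absz \o determinant))/eqP.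
by rewrite /= det_mulmx det1 abszM muln_eq1 => /andP[/eqP].
Qed.

Lemma image_setT_additive (V W : zmodType) (f : {additive V -> W}) :
  additive_subgroup (range f).
Proof. by apply: additive_subgroup_image; split. Qed.

Lemma diag_mx_subgroup_index (d : nat) (v : 'rV[int]_d) :
  (forall i, v 0 i != 0) ->
  finite_index [set: 'cV[int]_d] (range (mulmx (diag_mx v))) /\
  subgroup_index [set: 'cV[int]_d] (range (mulmx (diag_mx v)))
    = `|\det (diag_mx v)|%N.
Proof.
move=> v_neq0.
have -> : `|\det (diag_mx v)|%N = #|{dffun forall i : 'I_d, 'I_(`|v ord0 i|%N)}|.
  rewrite det_diag (big_morph absz abszM (erefl _)) card_dep_ffun foldrE.
  by rewrite big_image; apply: eq_bigr => i _; rewrite card_ord.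
(* Representatives are the vectors whose entry [i] is a remainder modulo the absolute value of
   [v 0 i]; their number is the product of these absolute values. *)
pose r (f : {dffun forall i : 'I_d, 'I_(`|v ord0 i|%N)}) : 'cV[int]_d :=
  \col_i (f i : nat)%:Z.
apply: (@coset_transversal_index _ _ _ _ r); first exact: image_setT_additive.
split=> // [x _|f g [q _ fgE]].
- have lt_mod i : (`|(x i ord0 %% v ord0 i)%Z| < `|v ord0 i|)%N.
    by rewrite -ltz_nat abszE ger0_norm ?modz_ge0// ltz_mod.
  exists [ffun i => Ordinal (lt_mod i)], (\col_i (x i ord0 %/ v ord0 i)%Z) => //.
  apply/colP => i; rewrite mul_diag_mx !mxE ffunE /=.
  rewrite [X in _ = X - _](divz_eq (x i ord0) (v ord0 i)) mulrC.
  by rewrite abszE ger0_norm ?modz_ge0// addrK.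
- apply/ffunP => i; apply: val_inj.
  move/colP/(_ i): fgE; rewrite mul_diag_mx !mxE => /eqP.
  rewrite eq_sym subr_eq mulrC => /eqP fgE.
  have := congr1 (fun z => (z %% v ord0 i)%Z) fgE.
  rewrite modzMDl -!(modz_abs _ (v ord0 i)) !modz_nat.
  by rewrite !modn_small//= => -[].
Qed.

(** The Smith normal form writes [M] as [L *m D *m U] with [D] diagonal and [L], [U] invertible over
    the integers. Since [U] and [L] map the integer vectors onto themselves, the index is that of
    the image of [D], transported by [L]. *)
Lemma mulmx_subgroup_index (d : nat) (M : 'M[int]_d) :
  \det M != 0 ->
  finite_index [set: 'cV[int]_d] (range (mulmx M)) /\
  subgroup_index [set: 'cV[int]_d] (range (mulmx M)) = `|\det M|%N.
Proof.
have [L uL [U uU [e _ ->]]] := int_Smith_normal_form M.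
set D := (X in _ *m X *m _).
have {D} -> : D = diag_mx (\row_i e`_i).
  by apply/matrixP => i j; rewrite !mxE; congr (_ *+ _).
set v := \row_i _; rewrite !det_mulmx => det_neq0.
have v_neq0 i : v 0 i != 0.
  apply: contraNneq det_neq0 => vi0.
  by rewrite det_diag (bigD1 i)//= vi0 mul0r mulr0 mul0r.
rewrite !abszM (absz_det_unit uL) (absz_det_unit uU) mul1n muln1.
have rangeE : range (mulmx (L *m diag_mx v *m U)) =
    mulmx L @` range (mulmx (diag_mx v)) :> set 'cV_d.
  apply/seteqP; split=> [_ [x _ <-]|_ [_ [x _ <-] <-]].
    exists (diag_mx v *m (U *m x)); last by rewrite !mulmxA.
    by exists (U *m x).
  by exists (invmx U *m x) => //; rewrite -!mulmxA mulKVmx.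
have setE : [set: 'cV[int]_d] = mulmx L @` [set: 'cV[int]_d].
  apply/seteqP; split=> // x _.
  by exists (invmx L *m x) => //; rewrite mulKVmx.
rewrite rangeE [X in finite_index X _]setE [X in subgroup_index X _]setE.
have [fin_v <-] := diag_mx_subgroup_index v_neq0.
apply: subgroup_index_image => //; last exact: image_setT_additive.
by move=> x y /(congr1 (mulmx (invmx L))); rewrite !mulKmx.
Qed.

Lemma finite_bounded_int_mx (d c : nat) :
  finite_set [set M : 'M[int]_d | forall i j, (`|M i j| <= c)%N].
Proof.
(* Integers from [-c] to [c] are encoded as naturals up to [2 c], shifted by [c]. *)
pose f (M : 'M['I_c.*2.+1]_d) : 'M[int]_d :=
  \matrix_(i, j) ((M i j : nat)%:Z - c%:Z).
apply: sub_finite_set (finite_image f (@finite_finset _ setT)) => M leMc.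
exists (\matrix_(i, j) inord (absz (M i j + c%:Z))) => //.
apply/matrixP => i j; rewrite !mxE.
have := leMc i j; move: (M i j) => z le_zc.
rewrite inordK; last by rewrite ltnS; lia.
lia.
Qed.

(** * Linear isometries and endomorphisms of lattices *)

Section Isometries.
Variables (R : realType) (d : nat).
Implicit Types (A B : 'M[R]_d) (G H : set 'cV[R]_d).

Lemma linear_isometryVr A : linear_isometry A -> A *m A^T = 1%:M.
Proof. exact: mulmx1C. Qed.

Lemma linear_isometry_tr A : linear_isometry A -> linear_isometry A^T.
Proof. by move=> /linear_isometryVr; rewrite /linear_isometry trmxK. Qed.

Lemma linear_isometry1 : linear_isometry (1%:M : 'M[R]_d).
Proof. by rewrite /linear_isometry trmx1 mulmx1. Qed.

Lemma linear_isometryM A B :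
  linear_isometry A -> linear_isometry B -> linear_isometry (A *m B).
Proof.
rewrite /linear_isometry => isoA isoB.
by rewrite trmx_mul mulmxA -[B^T *m _ *m _]mulmxA isoA mulmx1.
Qed.

Lemma linear_isometryK A (n : nat) (x : 'M[R]_(d, n)) :
  linear_isometry A -> A^T *m (A *m x) = x.
Proof. by move=> isoA; rewrite mulmxA isoA mul1mx. Qed.

Lemma linear_isometryVK A (n : nat) (x : 'M[R]_(d, n)) :
  linear_isometry A -> A *m (A^T *m x) = x.
Proof. by move=> isoA; rewrite mulmxA linear_isometryVr// mul1mx. Qed.

Lemma linear_isometry_inj A :
  linear_isometry A -> injective (mulmx A : 'cV_d -> 'cV_d).
Proof.
by move=> isoA x y /(congr1 (mulmx A^T)); rewrite !linear_isometryK.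
Qed.

Lemma linear_isometry_det A : linear_isometry A -> `|\det A| = 1.
Proof.
move=> /(congr1 determinant); rewrite det_mulmx det_tr det1 -expr2 => detA2.
by apply/eqP; rewrite -sqr_norm_eq1 detA2.
Qed.

(** The squares of the entries in a column add up to 1. *)
Lemma linear_isometry_entry_le1 A i j : linear_isometry A -> `|A i j| <= 1.
Proof.
move=> /matrixP/(_ j j); rewrite !mxE eqxx mulr1n (bigD1 i)//= mxE => A_eq1.
rewrite -(@expr_le1 _ 2)// real_normK ?num_real// expr2 -A_eq1 lerDl.
by apply: sumr_ge0 => k _; rewrite mxE -expr2 sqr_ge0.
Qed.

Lemma image_latticeM A B G :
  image_lattice (A *m B) G = image_lattice A (image_lattice B G).
Proof.
apply/seteqP; split=> [_ [x Gx <-]|_ [_ [x Gx <-] <-]].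
  by exists (B *m x); [exists x | rewrite mulmxA].
by exists x => //; rewrite mulmxA.
Qed.

Lemma image_lattice1 G : image_lattice 1%:M G = G.
Proof.
apply/seteqP; split=> [_ [x Gx <-]|x Gx]; first by rewrite mul1mx.
by exists x; rewrite ?mul1mx.
Qed.

Lemma image_latticeK A G :
  linear_isometry A -> image_lattice A^T (image_lattice A G) = G.
Proof. by move=> isoA; rewrite -image_latticeM isoA image_lattice1. Qed.

Lemma image_latticeS A G H :
  G `<=` H -> image_lattice A G `<=` image_lattice A H.
Proof. exact: image_subset. Qed.

Lemma image_latticeI A G H : linear_isometry A ->
  image_lattice A (G `&` H) = image_lattice A G `&` image_lattice A H.
Proof.
move=> isoA; apply/seteqP; split=> [_ [x [Gx Hx] <-]|_ [[x Gx <-] [y Hy]]].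
  by split; exists x.
by move=> /(linear_isometry_inj isoA) eq_yx; exists x; rewrite -?eq_yx //;
   split=> //; rewrite eq_yx.
Qed.

Lemma image_lattice_subgroup A G :
  additive_subgroup G -> additive_subgroup (image_lattice A G).
Proof. exact: additive_subgroup_image. Qed.

Lemma image_lattice_index A G H :
  linear_isometry A -> additive_subgroup H -> finite_index G H ->
  finite_index (image_lattice A G) (image_lattice A H) /\
  subgroup_index (image_lattice A G) (image_lattice A H) = subgroup_index G H.
Proof.
by move=> isoA; apply: subgroup_index_image; exact: linear_isometry_inj.
Qed.

Lemma full_rank_lattice_subgroup G :
  full_rank_lattice G -> additive_subgroup G.
Proof.
move=> [B _ ->].
exact: (image_setT_additive (mulmx B \o map_mx intr)).
Qed.

(** Column [j] of [M] consists of integer coordinates of the image of the basis vector [col j B]. *)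
Lemma endomorphism_int_mx G B A :
  G = [set B *m map_mx intr z | z in [set: 'cV[int]_d]] ->
  image_lattice A G `<=` G ->
  exists M : 'M[int]_d, A *m B = B *m map_mx intr M.
Proof.
move=> GE AGG.
have /choice[z zP] : forall j, exists z : 'cV[int]_d,
    A *m col j B = B *m map_mx intr z.
  move=> j; have : G (A *m col j B).
    apply: AGG; exists (col j B) => //; rewrite GE.
    by exists (delta_mx j 0) => //; rewrite map_delta_mx colE.
  by rewrite GE => -[z _ zE]; exists z.
exists (\matrix_(i, j) z j i 0).
apply/matrixP => i j; have /matrixP/(_ i 0) := zP j; rewrite !mxE.
under eq_bigr do rewrite mxE; move=> ->.
by apply: eq_bigr => k _; rewrite !mxE.
Qed.

(** In coordinates with respect to the basis [B], the map is an integer matrix with the same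
    determinant, so the index formula for integer matrices carries over. *)
Lemma endomorphism_index G A :
  full_rank_lattice G -> image_lattice A G `<=` G -> \det A != 0 ->
  finite_index G (image_lattice A G) /\
  (subgroup_index G (image_lattice A G))%:R = `|\det A|.
Proof.
move=> [B uB GE] AGG detA.
have [M ABE] := endomorphism_int_mx GE AGG.
have detE : \det A = (\det M)%:~R.
  have := congr1 determinant ABE; rewrite !det_mulmx det_map_mx mulrC.
  by apply: mulfI; rewrite -unitfE -unitmxE.
pose f : 'cV[int]_d -> 'cV[R]_d := mulmx B \o map_mx intr.
have f_inj : injective f.
  move=> x y /(congr1 (mulmx (invmx B))); rewrite !mulKmx//.
  move=> /matrixP xyE; apply/matrixP => i j.
  by have := xyE i j; rewrite !mxE => /intr_inj.
have GfE : G = range f by rewrite GE.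
have AGfE : image_lattice A G = f @` range (mulmx M).
  rewrite GE; apply/seteqP.
  split=> [_ [_ [x _ <-] <-]|_ [_ [x _ <-] <-]].
    by exists (M *m x); [exists x | rewrite /f/= map_mxM !mulmxA ABE].
  exists (B *m map_mx intr x); first by exists x.
  by rewrite /f/= map_mxM !mulmxA ABE.
have [|finM indM] := @mulmx_subgroup_index d M.
  by apply: contra_neq detA => M0; rewrite detE M0.
have [|fin_f ind_f] := subgroup_index_image (f := mulmx B \o map_mx intr)
  f_inj _ finM; first exact: image_setT_additive.
rewrite AGfE GfE ind_f indM; split=> //.
by rewrite detE -intr_norm -abszE.
Qed.

End Isometries.

(** * Coincidence isometries and their indices *)

Section CoincidenceIsometries.
Variables (R : realType) (d : nat) (G : set 'cV[R]_d).
Hypothesis latG : full_rank_lattice G.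
Let sG : additive_subgroup G := full_rank_lattice_subgroup latG.
Implicit Types A B : 'M[R]_d.

Lemma coincidence_site_lattice_subgroup A :
  additive_subgroup (coincidence_site_lattice G A).
Proof. by apply: additive_subgroupI => //; exact: image_lattice_subgroup. Qed.

Lemma coincidence_index_gt0 A :
  coincidence_isometry G A -> (0 < coincidence_index G A)%N.
Proof. by move=> [_]; exact: subgroup_index_gt0. Qed.

Lemma image_scalar_lattice (n : nat) :
  image_lattice n%:R%:M G = [set x *+ n | x in G].
Proof.
by apply: eq_imagel => x _; rewrite mul_scalar_mx scaler_nat.
Qed.

(** The multiple of [x] by the factorial lies in [A G], so [A^T] maps it back into [G]. Thus a known
    multiple of [A^T] is an endomorphism of the lattice. *)
Lemma coincidence_image_factorial A x : coincidence_isometry G A -> G x ->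
  G (((coincidence_index G A)`!)%:R *: A^T *m x).
Proof.
move=> [isoA finA] Gx.
have := subgroup_index_factorial sG (coincidence_site_lattice_subgroup A) finA Gx.
move=> [_ [y Gy yE]].
by rewrite -scalemxAl scalemxAr scaler_nat -yE linear_isometryK.
Qed.

(* As [|det A| = 1], the sublattice [N G] of [G] and [A G] has the same index
   [N ^ d] in both. *)
Lemma coincidence_index_image A : coincidence_isometry G A ->
  finite_index (image_lattice A G) (coincidence_site_lattice G A) /\
  subgroup_index (image_lattice A G) (coincidence_site_lattice G A)
    = coincidence_index G A.
Proof.
move=> cA; have [isoA finA] := cA.
set X := coincidence_site_lattice G A; set N := (coincidence_index G A)`!.
have sX : additive_subgroup X := coincidence_site_lattice_subgroup A.
have sAG := image_lattice_subgroup A sG.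
have N_neq0 : N%:R != 0 :> R by rewrite pnatr_eq0 -lt0n fact_gt0.
pose NG := image_lattice N%:R%:M G.
have NG_X : NG `<=` X.
  rewrite /NG image_scalar_lattice => _ [x Gx <-].
  exact: subgroup_index_factorial.
have sNG : additive_subgroup NG := image_lattice_subgroup _ sG.
have [||finNG indNG] := @endomorphism_index _ _ _ (N%:R%:M) latG.
- by move=> x /NG_X[].
- by rewrite det_scalar expf_neq0.
(* The isometry [A] carries [G] to [A G] and the image of [G] under [N%:R *: A^T] to [N G], so this
   index is the one of [N G] in [A G]. *)
have [||finC indC] := @endomorphism_index _ _ _ (N%:R *: A^T) latG.
- by move=> _ [x Gx <-]; exact: coincidence_image_factorial.
- rewrite detZ mulf_neq0 ?expf_neq0// -normr_eq0 linear_isometry_det ?oner_eq0//.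
  exact: linear_isometry_tr.
have [] := image_lattice_index isoA (image_lattice_subgroup _ sG) finC.
have -> : image_lattice A (image_lattice (N%:R *: A^T) G) = NG.
  by rewrite -image_latticeM -scalemxAr linear_isometryVr// scalemx1.
move=> finANG; move: indC.
rewrite detZ normrM linear_isometry_det ?mulr1; last exact: linear_isometry_tr.
rewrite -det_scalar -indNG => /eqP; rewrite eqr_nat => /eqP -> indANG.
have XG : X `<=` G by move=> x [].
have XAG : X `<=` image_lattice A G by move=> x [].
have [_ finX indX] := subgroup_index_tower sG sNG sX NG_X XG finNG.
have [fAX _ indAX] := subgroup_index_tower sAG sNG sX NG_X XAG finANG.
(* Both towers pass through [X]; the common factor, the index of [N G] in [X], is positive and
   cancels. *)
split=> //; apply/eqP; rewrite -(eqn_pmul2r (subgroup_index_gt0 sX finX)).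
by rewrite -indAX indANG -indX.
Qed.

(** Applying [A^T] turns [A G] into [G] and the coincidence site lattice of [A] into that of [A^T];
    the index of the former in [A G] is already known. *)
Lemma coincidence_isometry_tr A : coincidence_isometry G A ->
  coincidence_isometry G A^T /\
  coincidence_index G A^T = coincidence_index G A.
Proof.
move=> cA; have [isoA _] := cA; have isoAT := linear_isometry_tr isoA.
have [finA <-] := coincidence_index_image cA.
have [] := image_lattice_index isoAT (coincidence_site_lattice_subgroup A) finA.
rewrite image_latticeK//.
have -> : image_lattice A^T (coincidence_site_lattice G A) =
          coincidence_site_lattice G A^T.
  by rewrite image_latticeI// image_latticeK// setIC.
by move=> finAT <-.
Qed.

(** Let [Z] be the intersection of the site lattice of [A] with the image under [A] of the site
    lattice of [B]. It is contained in the site lattice of [A *m B], and its index in the site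
    lattice of [A] divides the index of [B]. Two towers from [G] down to [Z] give the
    divisibility. *)
Lemma coincidence_isometryM A B :
  coincidence_isometry G A -> coincidence_isometry G B ->
  coincidence_isometry G (A *m B) /\
  (coincidence_index G (A *m B) %|
     coincidence_index G A * coincidence_index G B)%N.
Proof.
move=> [isoA finA] [isoB finB].
have sAG := image_lattice_subgroup A sG.
have sX := coincidence_site_lattice_subgroup A.
have sY := coincidence_site_lattice_subgroup (A *m B).
have sL := image_lattice_subgroup A (coincidence_site_lattice_subgroup B).
have [finL indL] := image_lattice_index isoA
  (coincidence_site_lattice_subgroup B) finB.
have XAG : coincidence_site_lattice G A `<=` image_lattice A G by move=> x [].
have LAG : image_lattice A (coincidence_site_lattice G B) `<=` image_lattice A G.
  by apply: image_latticeS => x [].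
have XG : coincidence_site_lattice G A `<=` G by move=> x [].
have YG : coincidence_site_lattice G (A *m B) `<=` G by move=> x [].
have [finZ] := subgroup_index_capr sAG sL sX XAG LAG finL.
set Z := _ `&` _ in finZ *; rewrite indL => dvdZ.
have sZ : additive_subgroup Z := additive_subgroupI sX sL.
have ZX : Z `<=` coincidence_site_lattice G A by move=> x [].
have ZY : Z `<=` coincidence_site_lattice G (A *m B).
  move=> x [[Gx _]]; rewrite image_latticeI// => -[_].
  by rewrite -image_latticeM.
have [finGZ indGZ] := subgroup_index_trans sG sZ sX ZX XG finA finZ.
have [finY _ indY] := subgroup_index_tower sG sZ sY ZY YG finGZ.
split; first by split=> //; exact: linear_isometryM.
apply: (@dvdn_trans (subgroup_index G Z)); first by rewrite indY dvdn_mulr.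
by rewrite indGZ dvdn_mul.
Qed.

Lemma coincidence_isometry1 :
  coincidence_isometry G 1%:M /\ coincidence_index G 1%:M = 1%N.
Proof.
have cslE : coincidence_site_lattice G 1%:M = G.
  by rewrite /coincidence_site_lattice image_lattice1 setIid.
have [fin1 ind1] := subgroup_index_self sG.
rewrite /coincidence_isometry /coincidence_index cslE.
by split=> //; split=> //; exact: linear_isometry1.
Qed.

(** Index 1 only says that [G] is contained in [A G]; the other inclusion follows from the same fact
    for [A^T], which also has index 1. *)
Lemma point_groupP A :
  point_group G A <-> coincidence_isometry G A /\ coincidence_index G A = 1%N.
Proof.
split=> [[isoA AG]|[cA indA]].
  have [[_ fin1] ind1] := coincidence_isometry1.
  move: fin1 ind1; rewrite /coincidence_isometry /coincidence_index.
  by rewrite /coincidence_site_lattice image_lattice1 AG.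
have sub_image B : coincidence_isometry G B -> coincidence_index G B = 1%N ->
    G `<=` image_lattice B G.
  move=> [_ finB] indB x Gx.
  have sX := coincidence_site_lattice_subgroup B.
  by have [] := subgroup_index_eq1 sG sX finB indB Gx.
have [isoA _] := cA; have [cAT indAT] := coincidence_isometry_tr cA.
split=> //; apply/seteqP; split; last exact: sub_image.
rewrite -{2}[G](image_latticeK (A := A^T)); last exact: linear_isometry_tr.
by rewrite trmxK; apply/image_latticeS/sub_image => //; rewrite indAT.
Qed.

(** Since [A] is the product of [A *m B] and [B^T], its index divides that of [A *m B] times that of
    [B], and coprimality removes the last factor. The same works for [B]. *)
Lemma coincidence_index_coprimeM A B :
  coincidence_isometry G A -> coincidence_isometry G B ->
  coprime (coincidence_index G A) (coincidence_index G B) ->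
  coincidence_index G (A *m B) =
    (coincidence_index G A * coincidence_index G B)%N.
Proof.
move=> cA cB co_AB; have [cAB dvdAB] := coincidence_isometryM cA cB.
have [cAT indAT] := coincidence_isometry_tr cA.
have [cBT indBT] := coincidence_isometry_tr cB.
apply/eqP; rewrite eqn_dvd dvdAB Gauss_dvd//.
have [_] := coincidence_isometryM cAB cBT.
rewrite -mulmxA linear_isometryVr ?mulmx1; last by have [] := cB.
rewrite indBT Gauss_dvdl// => -> /=.
have [_] := coincidence_isometryM cAT cAB.
by rewrite linear_isometryK ?indAT ?Gauss_dvdr 1?coprime_sym//; have [] := cA.
Qed.

(** The multiple of [A] by the factorial of [m] preserves [G], so it is given by an integer matrix
    [M] in the lattice basis. The entries of an isometry are bounded by 1, which bounds those of [M]
    and leaves finitely many choices. *)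
Lemma finite_coincidence_isometries m : finite_set
  [set A : 'M[R]_d | coincidence_isometry G A /\ coincidence_index G A = m].
Proof.
have [B uB GE] := latG.
(* This bounds entry [(i, j)] of [invmx B *m A *m B], scaled by the factorial of [m], once each
   entry of [A] is replaced by 1 and the others by absolute values. *)
pose c i j := m`!%:R * \sum_l (\sum_k `|invmx B i k|) * `|B l j|.
pose C := \max_(u : 'I_d * 'I_d) Num.bound (c u.1 u.2).
pose f (M : 'M[int]_d) : 'M[R]_d :=
  m`!%:R^-1 *: (B *m map_mx intr M *m invmx B).
apply: sub_finite_set (finite_image f (finite_bounded_int_mx d C)).
move=> A [cA indA]; have [cAT indAT] := coincidence_isometry_tr cA.
have m_neq0 : m`!%:R != 0 :> R by rewrite pnatr_eq0 -lt0n fact_gt0.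
have [|M ABE] := @endomorphism_int_mx _ _ G B (m`!%:R *: A) GE.
  move=> _ [x Gx <-]; rewrite -[A]trmxK -indA -indAT.
  exact: coincidence_image_factorial.
exists M; last by rewrite /f -ABE mulmxK// scalerA mulVf// scale1r.
move=> i j; rewrite -(ler_nat R) natr_absz.
have -> : (`|M i j|%:~R : R) = `|(m`!%:R *: (invmx B *m A *m B)) i j|.
  have -> : m`!%:R *: (invmx B *m A *m B) = map_mx intr M.
    by rewrite -mulmxA scalemxAr scalemxAl ABE mulKmx.
  by rewrite mxE intr_norm.
apply: (@le_trans _ _ (c i j)); last first.
  have c_ge0 : 0 <= c i j.
    rewrite mulr_ge0 ?ler0n// sumr_ge0// => l _.
    by rewrite mulr_ge0// sumr_ge0.
  apply: le_trans (ltW (archi_boundP c_ge0)) _; rewrite ler_nat.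
  exact: (leq_bigmax (F := fun u => Num.bound (c u.1 u.2)) (i, j)).
rewrite !mxE normrM ger0_norm ?ler0n// ler_wpM2l ?ler0n//.
apply: le_trans (ler_norm_sum _ _ _) _; apply: ler_sum => l _.
rewrite normrM ler_wpM2r// mxE.
apply: le_trans (ler_norm_sum _ _ _) _; apply: ler_sum => k _.
rewrite normrM ler_piMr// linear_isometry_entry_le1//.
by have [] := cA.
Qed.

End CoincidenceIsometries.

(** * Orderings of the primes *)

Lemma pnat_gt0 (pi : nat_pred) n : pi.-nat n -> (0 < n)%N.
Proof. by case/andP. Qed.

Lemma prime_ordering_exists : exists p, prime_ordering p.
Proof.
apply/card_set_bijP; rewrite card_eq_sym.
apply: eq_card_nat; first exact: countableP.
move=> /finite_seqP[s primesE].
have [q lt_q q_pr] := prime_above (\max_(i <- s) i).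
have : [set q | prime q] q by [].
rewrite primesE => /= qs.
by move: lt_q; rewrite ltnNge (leq_bigmax_seq (F := id)).
Qed.

Lemma prime_orderingP p : prime_ordering p ->
  [/\ forall i, prime (p i), injective p &
      forall q, prime q -> exists i, p i = q].
Proof.
move=> [p_pr p_inj p_surj]; split=> [i|i j|q /p_surj[i _ <-]]; last by exists i.
- exact: p_pr.
- by apply: p_inj; rewrite inE.
Qed.

(** Being a [nat_pred], this set of primes can be used with [pi.-nat] and with the pi-parts of
    numbers. *)
Definition first_primes (p : nat -> nat) (n : nat) : nat_pred :=
  [pred q | q \in [seq p i | i <- iota 0 n]].

Lemma mem_first_primes p n i :
  injective p -> (p i \in first_primes p n) = (i < n)%N.
Proof. by move=> p_inj; rewrite inE mem_map// mem_iota. Qed.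

Lemma first_primesS p n :
  first_primes p n.+1 =i predU1 (p n) (first_primes p n).
Proof.
move=> q; rewrite -[LHS]/(q \in [seq p i | i <- iota 0 n.+1]) -addn1 iotaD.
by rewrite map_cat mem_cat mem_seq1 orbC.
Qed.

(** This form serves an induction that splits off the first prime and shifts the ordering. *)
Lemma first_primesSl p n :
  first_primes p n.+1 =i predU1 (p 0%N) (first_primes (p \o succn) n).
Proof.
move=> q; rewrite -[LHS]/(q \in p 0%N :: [seq p i | i <- iota (1 + 0) n]).
by rewrite in_cons iotaDl -map_comp.
Qed.

Lemma pnat_first_primes_exists p m :
  prime_ordering p -> (0 < m)%N -> exists n, (first_primes p n).-nat m.
Proof.
move=> /prime_orderingP[_ p_inj p_surj] m_gt0.
have /choice[g gP] : forall q, exists i, prime q -> p i = q.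
  by move=> q; have [/p_surj[i <-]|] := boolP (prime q); [exists i | exists 0%N].
(* A prime divisor of [m] is at most [m], so its position [g q] is among those in the maximum. *)
exists (\max_(q < m.+1) g q).+1; apply/pnatP => // q q_pr q_dvd.
rewrite -(gP q q_pr) mem_first_primes// ltnS.
have lt_qm : (q < m.+1)%N by rewrite ltnS dvdn_leq.
exact: (leq_bigmax (F := fun q : 'I_m.+1 => g q) (Ordinal lt_qm)).
Qed.

(** This gives access to the splitting lemmas for iterated products. *)
HB.instance Definition _ (R : pzSemiRingType) (n : nat) :=
  Monoid.isLaw.Build 'M[R]_n 1%:M (@mulmx R n n n)
    (@mulmxA R n n n n) (@mul1mx R n n) (@mulmx1 R n n).

(** * Counting products of coincidence isometries *)

Section Counting.
Variables (R : realType) (d : nat) (G : set 'cV[R]_d).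
Hypothesis latG : full_rank_lattice G.
Implicit Types A B : 'M[R]_d.

Definition coincidence_isometries (m : nat) : set 'M[R]_d :=
  [set A | coincidence_isometry G A /\ coincidence_index G A = m].

Definition coincidence_products (m n : nat) : set 'M[R]_d :=
  [set A *m B | A in coincidence_isometries m & B in coincidence_isometries n].

Definition pi_coincidence (pi : nat_pred) A :=
  coincidence_isometry G A /\ pi.-nat (coincidence_index G A).

Lemma pi_coincidence1 pi : pi_coincidence pi 1%:M.
Proof.
by have [c1 ind1] := coincidence_isometry1 latG; split=> //; rewrite ind1.
Qed.

Lemma pi_coincidence_tr pi A : pi_coincidence pi A -> pi_coincidence pi A^T.
Proof.
move=> [cA piA]; have [cAT indAT] := coincidence_isometry_tr latG cA.
by split=> //; rewrite indAT.
Qed.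

Lemma pi_coincidenceM pi A B :
  pi_coincidence pi A -> pi_coincidence pi B -> pi_coincidence pi (A *m B).
Proof.
move=> [cA piA] [cB piB]; have [cAB dvdAB] := coincidence_isometryM latG cA cB.
by split=> //; apply: (pnat_dvd dvdAB); rewrite pnatM piA.
Qed.

Lemma pi_pi'_coincidence pi A :
  pi_coincidence pi A -> pi_coincidence pi^' A -> point_group G A.
Proof.
move=> [cA piA] [_ pi'A]; apply/(point_groupP latG); split=> //.
exact: pnat_1 piA pi'A.
Qed.

Lemma coincidence_isometriesM m n A B : coprime m n ->
  coincidence_isometries m A -> coincidence_isometries n B ->
  coincidence_isometries (m * n) (A *m B).
Proof.
move=> co_mn [cA indA] [cB indB].
have [cAB _] := coincidence_isometryM latG cA cB.
by split=> //; rewrite coincidence_index_coprimeM// indA indB.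
Qed.

Lemma coincidence_isometries1 : coincidence_isometries 1 = point_group G.
Proof. by apply/seteqP; split=> A; rewrite (point_groupP latG). Qed.

Lemma coincidence_products_fiber m n A B A' B' : coprime m n ->
  coincidence_isometries m A -> coincidence_isometries n B ->
  coincidence_isometries m A' -> coincidence_isometries n B' ->
  A *m B = A' *m B' -> point_group G (A^T *m A').
Proof.
move=> co_mn [cA indA] [cB indB] [cA' indA'] [cB' indB'] eqAB.
have [[isoA _] [isoB' _]] := (cA, cB').
have [cAT indAT] := coincidence_isometry_tr latG cA.
have [cBT' indBT'] := coincidence_isometry_tr latG cB'.
have [cQ] := coincidence_isometryM latG cAT cA'.
(* Written with the first factors, the quotient has index dividing [m * m]; written with the second
   factors, [n * n]. *)
have QE : A^T *m A' = B *m B'^T.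
  by rewrite -[B in RHS](linear_isometryK _ isoA) eqAB -!mulmxA
    linear_isometryVr// mulmx1.
have [_] := coincidence_isometryM latG cB cBT'.
rewrite -QE indAT indA indA' indB indBT' indB' => dvd_n dvd_m.
apply/(point_groupP latG); split=> //; apply/eqP; rewrite -dvdn1.
have /eqP <- : coprime (m * m) (n * n) by rewrite coprimeMl !coprimeMr co_mn.
by rewrite dvdn_gcd dvd_m.
Qed.

(** Fix one factorization [c X] of each product [X]. Any other one arises by inserting a point group
    element [Q] and its inverse between the two factors, so [h] is a bijection from the pairs
    [(Q, X)] to the pairs of factors. *)
Lemma card_coincidence_products m n : coprime m n ->
  (#|` fset_set (coincidence_isometries m)| *
     #|` fset_set (coincidence_isometries n)| =
   #|` fset_set (point_group G)| *
     #|` fset_set (coincidence_products m n)|)%N.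
Proof.
move=> co_mn.
have fin_iso k : finite_set (coincidence_isometries k).
  exact: finite_coincidence_isometries.
have finP : finite_set (point_group G) by rewrite -coincidence_isometries1.
have fin_prod : finite_set (coincidence_products m n) by exact: finite_image2.
rewrite -(card_fset_setX (fin_iso m) (fin_iso n)) -(card_fset_setX finP fin_prod).
apply/(fcard_eq (finite_setX (fin_iso m) (fin_iso n)) (finite_setX finP fin_prod)).
have /choice[c cP] : forall X, exists u : 'M[R]_d * 'M[R]_d,
    coincidence_products m n X -> [/\ coincidence_isometries m u.1,
      coincidence_isometries n u.2 & u.1 *m u.2 = X].
  move=> X; have [[A mA [B nB <-]]|noX] := pselect (coincidence_products m n X).
    by exists (A, B).
  by exists (1%:M, 1%:M).
pose h (u : 'M[R]_d * 'M[R]_d) := ((c u.2).1 *m u.1, u.1^T *m (c u.2).2).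
have hM u : point_group G u.1 -> coincidence_products m n u.2 ->
    (h u).1 *m (h u).2 = u.2.
  move=> [isoQ _] /cP[_ _ cM] /=.
  by rewrite -mulmxA linear_isometryVK.
have -> : coincidence_isometries m `*` coincidence_isometries n =
          h @` (point_group G `*` coincidence_products m n).
  apply/seteqP; split=> [[A B] [/= mA nB]|_ [[Q X] [/= PQ pX] <-]].
    have pAB : coincidence_products m n (A *m B) by exists A => //; exists B.
    have [mc nc cM] := cP _ pAB.
    have PQ := coincidence_products_fiber co_mn mc nc mA nB cM.
    have [isoc _] := mc.1; have [isoA _] := mA.1.
    exists ((c (A *m B)).1^T *m A, A *m B) => //; rewrite /h /=.
    rewrite linear_isometryVK// trmx_mul trmxK -mulmxA cM.
    by rewrite linear_isometryK.
  have [mc nc _] := cP _ pX.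
  have [PQ1 PQT1] : coincidence_isometries 1 Q /\ coincidence_isometries 1 Q^T.
    have [cQ indQ] := (point_groupP latG Q).1 PQ.
    have [cQT indQT] := coincidence_isometry_tr latG cQ.
    by split; split=> //; rewrite indQT.
  split=> /=.
    by rewrite -[m]muln1; apply: coincidence_isometriesM => //; rewrite coprimen1.
  by rewrite -[n]mul1n; apply: coincidence_isometriesM => //; rewrite coprime1n.
apply: inj_card_eq => -[Q X] [Q' X'].
rewrite !inE => -[/= PQ pX] [/= PQ' pX'] eq_h.
(* The product of the two components of [h] recovers [X]; cancelling the first factor of [c X] then
   recovers [Q]. *)
have eqX : X = X'.
  have XE : (h (Q, X)).1 *m (h (Q, X)).2 = X := hM (Q, X) PQ pX.
  by rewrite -XE eq_h; exact: (hM (Q', X')).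
move: eq_h; rewrite -eqX => -[/(congr1 (mulmx (c X).1^T)) + _].
have [mc _ _] := cP _ pX; have [isoc _] := mc.1.
by rewrite !linear_isometryK// => ->.
Qed.

Lemma card_point_group_neq0 : #|` fset_set (point_group G)|%:R != 0 :> rat.
Proof.
rewrite pnatr_eq0 -lt0n cardfs_gt0; apply/fset0Pn; exists 1%:M.
rewrite -coincidence_isometries1 in_fset_set ?inE; first exact: coincidence_isometry1.
exact: finite_coincidence_isometries.
Qed.

(** The right-hand side counts the products, again divided by the order of the point group. As the
    products form a subset of a finite set, equal cardinalities mean equal sets. *)
Lemma f_isoM m n : coprime m n ->
  f_iso G (m * n)%N = f_iso G m * f_iso G n <->
  coincidence_isometries (m * n) `<=` coincidence_products m n.
Proof.
move=> co_mn; have P_neq0 := card_point_group_neq0.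
have subM : coincidence_products m n `<=` coincidence_isometries (m * n).
  by move=> _ [A mA [B nB <-]]; exact: coincidence_isometriesM.
have finM := finite_coincidence_isometries latG (m * n).
have fin_prod : finite_set (coincidence_products m n) by exact: sub_finite_set finM.
have -> : f_iso G m * f_iso G n = #|` fset_set (coincidence_products m n)|%:R /
    #|` fset_set (point_group G)|%:R.
  rewrite /f_iso -!/(coincidence_isometries _) mulf_div -natrM.
  by rewrite card_coincidence_products// natrM -mulf_div divff// mul1r.
rewrite /f_iso -/(coincidence_isometries _).
have le_prod : (fset_set (coincidence_products m n)
    `<=` fset_set (coincidence_isometries (m * n)))%fset.
  by rewrite -fset_set_sub.
split=> [/(divIf P_neq0)/eqP|subP]; last first.
  by congr (#|` fset_set _|%:R / _); apply/seteqP.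
rewrite eqr_nat => /eqP eq_card; rewrite fset_set_sub//.
have /eqP <- // : fset_set (coincidence_products m n) ==
  fset_set (coincidence_isometries (m * n)).
by rewrite eqEfcard le_prod eq_card leqnn.
Qed.

Lemma f_iso1 : f_iso G 1 = 1.
Proof.
rewrite /f_iso -/(coincidence_isometries 1) coincidence_isometries1.
by rewrite divff// card_point_group_neq0.
Qed.

(** * Decompositions along an ordering of the primes *)

Section Decompositions.
Variable p : nat -> nat.

(** The identity factors read off beyond the end have index [p i ^ 0], so a decomposition may be
    taken at any larger length. *)
Lemma prime_decomposition_nth A s : prime_decomposition G p A s ->
  (forall i, exists k, coincidence_isometry G (nth 1%:M s i) /\
    coincidence_index G (nth 1%:M s i) = (p i ^ k)%N) /\
  forall n, (size s <= n)%N ->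
    A = \big[mulmx/1%:M]_(0 <= i < n) nth 1%:M s i.
Proof.
move=> [AE sP]; split=> [i|n le_sn].
  have [/sP[ci [k ik]]|le_si] := ltnP i (size s); first by exists k.
  exists 0%N; rewrite nth_default// expn0; exact: coincidence_isometry1.
rewrite (@big_cat_nat _ _ _ (size s))//= -(big_nth 1%:M xpredT id) -AE.
rewrite big_nat big1 ?mulmx1// => i /andP[le_si _].
by rewrite nth_default.
Qed.

Hypothesis p_order : prime_ordering p.
Let p_prime : forall i, prime (p i).
Proof. by have [] := prime_orderingP p_order. Qed.
Let p_inj : injective p.
Proof. by have [] := prime_orderingP p_order. Qed.

Lemma prefix_pi_coincidence A s n : prime_decomposition G p A s ->
  pi_coincidence (first_primes p n)
    (\big[mulmx/1%:M]_(0 <= i < n) nth 1%:M s i).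
Proof.
move=> /prime_decomposition_nth[sP _]; rewrite big_nat.
apply: (big_ind (pi_coincidence _)); first exact: pi_coincidence1.
- by move=> B C; exact: pi_coincidenceM.
- move=> i /= lt_in; have [k [ci ik]] := sP i; split=> //.
  by rewrite ik pnatX pnatE// mem_first_primes// lt_in.
Qed.

Lemma suffix_pi_coincidence A s n m : prime_decomposition G p A s ->
  pi_coincidence (first_primes p n)^'
    (\big[mulmx/1%:M]_(n <= i < m) nth 1%:M s i).
Proof.
move=> /prime_decomposition_nth[sP _]; rewrite big_nat.
apply: (big_ind (pi_coincidence _)); first exact: pi_coincidence1.
- by move=> B C; exact: pi_coincidenceM.
- move=> i /andP[le_ni _]; have [k [ci ik]] := sP i; split=> //.
  by rewrite ik pnatX pnatE// inE/= mem_first_primes// -leqNgt le_ni.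
Qed.

Lemma prime_decomposition_unique A : unique_decomposition G p A.
Proof.
move=> s t sA tA n.
pose S i := \big[mulmx/1%:M]_(0 <= j < i) nth 1%:M s j.
pose T i := \big[mulmx/1%:M]_(0 <= j < i) nth 1%:M t j.
have isoS i : linear_isometry (S i) by have [[]] := prefix_pi_coincidence i sA.
have isoT i : linear_isometry (T i) by have [[]] := prefix_pi_coincidence i tA.
have SnE : A = S n by apply: (prime_decomposition_nth sA).2; exact: leq_maxl.
have TnE : A = T n by apply: (prime_decomposition_nth tA).2; exact: leq_maxr.
have QP i : (i <= n)%N -> point_group G ((S i)^T *m T i).
  move=> le_in; apply: (@pi_pi'_coincidence (first_primes p i)).
    apply: pi_coincidenceM; last exact: prefix_pi_coincidence tA.
    by apply: pi_coincidence_tr; exact: prefix_pi_coincidence sA.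
  (* The remaining products [S'] and [T'] complete [S i] and [T i] to the same [A], which rewrites
     the quotient in terms of factors beyond position [i]. *)
  set S' := \big[mulmx/1%:M]_(i <= j < n) nth 1%:M s j.
  set T' := \big[mulmx/1%:M]_(i <= j < n) nth 1%:M t j.
  have ST : S i *m S' = T i *m T'.
    by rewrite -!big_cat_nat//= -/(S n) -SnE TnE.
  have piT' : pi_coincidence (first_primes p i)^' T'.
    exact: suffix_pi_coincidence tA.
  have -> : (S i)^T *m T i = S' *m T'^T.
    rewrite -[S'](linear_isometryK _ (isoS i)) ST -!mulmxA.
    by rewrite linear_isometryVr ?mulmx1//; have [[]] := piT'.
  apply: pi_coincidenceM; first exact: suffix_pi_coincidence sA.
  exact: pi_coincidence_tr.
(* With this choice the conjugated factor telescopes: [S i] times factor [i] of [s] is [S i.+1],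
   which cancels against its transpose and leaves [(T i)^T *m T i.+1], that is, factor [i] of
   [t]. *)
exists (fun i => (S i)^T *m T i); split=> // [||i lt_in].
- by rewrite /S /T !big_geq// trmx1 mulmx1.
- by rewrite -SnE -TnE SnE; exact: isoS.
- have [isoQ _] := QP i (ltnW lt_in).
  have -> : invmx ((S i)^T *m T i) = (T i)^T *m S i.
    have -> : (T i)^T *m S i = ((S i)^T *m T i)^T by rewrite trmx_mul trmxK.
    by rewrite -[RHS](mulmxK (mulmx1_unit isoQ).2) isoQ mul1mx.
  rewrite -[_ *m nth _ _ _]mulmxA.
  have -> : S i *m nth 1%:M s i = S i.+1 by rewrite /S big_nat_recr.
  rewrite -mulmxA linear_isometryVK//.
  have -> : T i.+1 = T i *m nth 1%:M t i by rewrite /T big_nat_recr.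
  by rewrite linear_isometryK.
Qed.

(** Cut the decomposition before position [i]. The indices of the two pieces are the part of [m * n]
    at the first [i] primes and the complementary part, hence [m] and [n]. *)
Lemma has_decomposition_split A m n i : has_decomposition G p A ->
  (first_primes p i).-nat m -> (first_primes p i)^'.-nat n ->
  coincidence_isometries (m * n) A -> coincidence_products m n A.
Proof.
move=> [s sA] pi_m pi'_n [_ indA].
set pi := first_primes p i in pi_m pi'_n *.
have [cB piB] := prefix_pi_coincidence i sA.
(* The upper bound is a maximum because [i] may exceed the length of [s]. *)
have [cC pi'C] := suffix_pi_coincidence i (maxn i (size s)) sA.
move: cB piB cC pi'C.
have := (prime_decomposition_nth sA).2 _ (leq_maxr i (size s)).
rewrite (big_cat_nat (leq0n i) (leq_maxl i _))/=.
set B := \big[_/_]_(0 <= j < i) _; set C := \big[_/_]_(i <= j < _) _.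
move=> AE cB piB cC pi'C.
have co_BC := pnat_coprime piB pi'C.
have indE := coincidence_index_coprimeM latG cB cC co_BC.
rewrite -AE indA in indE.
have partE a b : pi.-nat a -> pi^'.-nat b -> ((a * b)`_pi = a)%N.
  move=> pia pi'b; rewrite (partnM _ (pnat_gt0 pia) (pnat_gt0 pi'b)).
  by rewrite part_pnat_id// part_p'nat// muln1.
have indB : coincidence_index G B = m.
  by rewrite -(partE _ _ piB pi'C) -indE partE.
exists B; first by split.
exists C => //; split=> //; apply/eqP.
rewrite -(eqn_pmul2l (pnat_gt0 pi_m)) indE indB//.
Qed.

(** Splitting gives [f_part]. Induction on the number [i] of primes allowed in [m] and [n] then
    treats the parts at the first [i] primes by hypothesis and the parts at [p i] directly. *)
Lemma has_decomposition_multiplicative :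
  (forall A, coincidence_isometry G A -> has_decomposition G p A) ->
  multiplicative_function (f_iso G).
Proof.
move=> dec.
have f_part i m : (0 < m)%N ->
    f_iso G m = f_iso G m`_(first_primes p i) * f_iso G m`_(first_primes p i)^'.
  move=> m_gt0; rewrite -[in LHS](partnC (first_primes p i) m_gt0).
  apply/(f_isoM (coprime_partC _ _ _)) => A iA.
  apply: has_decomposition_split (dec _ iA.1) _ _ iA; exact: part_pnat.
have f_pi i m n : (first_primes p i).-nat m -> (first_primes p i).-nat n ->
    coprime m n -> f_iso G (m * n)%N = f_iso G m * f_iso G n.
  elim: i m n => [|i IHi] m n pi_m pi_n co_mn.
    have pi0 k : (first_primes p 0).-nat k -> k = 1%N.
      by move=> pi_k; apply: (pnat_1 pi_k); apply: sub_in_pnat (pi_k).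
    by rewrite (pi0 _ pi_m) (pi0 _ pi_n) f_iso1 mulr1.
  have [m_gt0 n_gt0] := (pnat_gt0 pi_m, pnat_gt0 pi_n).
  have co_part pi : coprime m`_pi n`_pi.
    apply: coprime_dvdl (dvdn_part _ _) _.
    exact: coprime_dvdr (dvdn_part _ _) _.
  rewrite (f_part i) ?muln_gt0 ?m_gt0// (f_part i m)// (f_part i n)//.
  rewrite !partnM// IHi ?part_pnat// [RHS]mulrACA; congr (_ * _).
  have prime_eq k q : (first_primes p i.+1).-nat k -> prime q ->
      (q %| k`_(first_primes p i)^')%N -> q = p i.
    move=> pi_k q_pr q_dvd.
    have : q \in first_primes p i.+1.
      have k_gt0 := pnat_gt0 pi_k.
      by apply: (pnatP _ k_gt0 pi_k) => //; exact: dvdn_trans q_dvd (dvdn_part _ _).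
    have := pnatP _ (part_gt0 _ k) (part_pnat (first_primes p i)^' k) q q_pr q_dvd.
    by rewrite inE /= first_primesS !inE /= => /negbTE ->; rewrite orbF => /eqP.
  (* The complementary parts have no prime divisor but [p i]; being coprime, one of them is 1. *)
  have [->|m_neq1] := eqVneq (m`_(first_primes p i)^')%N 1%N.
    by rewrite mul1n f_iso1 mul1r.
  have [->|n_neq1] := eqVneq (n`_(first_primes p i)^')%N 1%N.
    by rewrite muln1 f_iso1 mulr1.
  have gt1 k : (k`_(first_primes p i)^' != 1)%N -> (1 < k`_(first_primes p i)^')%N.
    by move=> k_neq1; rewrite ltn_neqAle eq_sym k_neq1 part_gt0.
  have pm := pdiv_prime (gt1 _ m_neq1); have pn := pdiv_prime (gt1 _ n_neq1).
  have := pdiv_dvd m`_(first_primes p i)^'.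
  have := pdiv_dvd n`_(first_primes p i)^'.
  rewrite (prime_eq _ _ pi_m pm (pdiv_dvd _)) (prime_eq _ _ pi_n pn (pdiv_dvd _)).
  move=> dvd_n dvd_m; have : (p i %| 1)%N.
    by rewrite -(eqP (co_part (first_primes p i)^')) dvdn_gcd dvd_m.
  by rewrite Euclid_dvd1.
move=> m n m_gt0 n_gt0 co_mn.
have mn_gt0 : (0 < m * n)%N by rewrite muln_gt0 m_gt0.
have [i] := pnat_first_primes_exists p_order mn_gt0.
by rewrite pnatM => /andP[pi_m pi_n]; exact: (f_pi i).
Qed.

End Decompositions.

(** Multiplicativity splits off a factor [B] whose index is the full power of [p 0], and induction
    decomposes the rest. Only primality of the values of [p] is assumed, because the induction
    passes to [p \o succn]. *)
Lemma has_decomposition_pnat p n A :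
  multiplicative_function (f_iso G) -> (forall i, prime (p i)) ->
  pi_coincidence (first_primes p n) A -> has_decomposition G p A.
Proof.
move=> mulf; elim: n p A => [|n IHn] p A p_pr [cA pi_A].
  exists [:: A]; rewrite /prime_decomposition big_seq1; split=> // -[]//= _.
  split=> //; exists 0%N; apply: (pnat_1 pi_A).
  by apply: sub_in_pnat (pi_A).
have A_gt0 := pnat_gt0 pi_A; set N := coincidence_index G A in pi_A A_gt0.
have fM : f_iso G N = f_iso G N`_(p 0%N) * f_iso G N`_(p 0%N)^'.
  by rewrite -[in LHS](partnC (p 0%N) A_gt0) mulf// coprime_partC.
rewrite -[in LHS](partnC (p 0%N) A_gt0) in fM.
have [|B [cB indB] [C [cC indC] BC]] := (f_isoM (coprime_partC _ _ _)).1 fM A.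
  by split=> //; rewrite partnC.
have [|s [sC sP]] := IHn (p \o succn) C (fun i => p_pr i.+1).
  (* The primes dividing the index of [C] are among the first [n.+1] but differ from [p 0], so they
     are among the first [n] of the shifted sequence. *)
  split=> //; rewrite indC; apply/pnatP => // q q_pr q_dvd.
  have := pnatP _ (part_gt0 _ N) (part_pnat (p 0%N)^' N) q q_pr q_dvd.
  have := pnatP _ A_gt0 pi_A q q_pr (dvdn_trans q_dvd (dvdn_part _ _)).
  by rewrite first_primesSl !inE /= => /orP[/eqP ->|//]; rewrite eqxx.
exists (B :: s); rewrite /prime_decomposition big_cons -sC BC.
split=> // -[_|i lt_is] /=; last exact: sP.
by split=> //; exists (logn (p 0%N) N); rewrite indB p_part.
Qed.

End Counting.

Theorem theorem8 (R : realType) (d : nat) (G : set 'cV[R]_d)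
    (G_lattice : full_rank_lattice G) :
  [<-> multiplicative_function (f_iso G);
       exists p : nat -> nat, prime_ordering p /\
         forall A : 'M[R]_d, coincidence_isometry G A ->
           has_decomposition G p A /\ unique_decomposition G p A;
       forall p : nat -> nat, prime_ordering p ->
         forall A : 'M[R]_d, coincidence_isometry G A ->
           has_decomposition G p A].
Proof.
have decompose : multiplicative_function (f_iso G) ->
    forall p, prime_ordering p -> forall A, coincidence_isometry G A ->
      has_decomposition G p A.
  move=> mulf p p_order A cA.
  have [p_pr _ _] := prime_orderingP p_order.
  have [n piA] := pnat_first_primes_exists p_order
    (coincidence_index_gt0 G_lattice cA).
  by apply: (has_decomposition_pnat G_lattice mulf p_pr (n := n)); split.
tfae.
- move=> mulf; have [p p_order] := prime_ordering_exists.
  exists p; split=> // A cA; split; first exact: decompose.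
  exact: prime_decomposition_unique.
(* The passage from one ordering to all of them goes through multiplicativity. *)
- move=> [p [p_order dec]]; apply: decompose.
  apply: (has_decomposition_multiplicative G_lattice p_order) => A cA.
  by have [] := dec A cA.
(* Some ordering must exist for the statement about all orderings to say anything. *)
- move=> dec; have [p p_order] := prime_ordering_exists.
  apply: (has_decomposition_multiplicative G_lattice p_order).
  exact: dec.
Qed.
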